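(* For each integer $p\geq 2$, there exists a positive constant $c_p$ such that ${\rm ex}(n, L_3(\theta_{3,p}))\leq c_p n^{7/5}$ for all $n$.
   Context: $\theta_{3,p}$ is the graph consisting of $p$ internally vertex-disjoint paths of length $3$ joining a pair of vertices; it is bipartite and symmetric between its two parts. For a bipartite graph $H$ with an ordered pair $(A,B)$ of parts and an integer $t\ge 2$, $L_t(H)$ is obtained from $H$ by adding a new vertex $u$ and joining $u$ to every vertex of $A$ by internally disjoint paths of length $t-1$ whose internal vertices are new (disjoint from $V(H)$). ${\rm ex}(n,H)$ is the maximum number of edges in an $n$-vertex graph containing no copy of $H$. *)

(* Defs.v *)
From HB Require Import structures.
From mathcomp Require Import all_boot.

Set Implicit Arguments.
Unset Strict Implicit.
Unset Printing Implicit Defensive.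

Local Open Scope nat_scope.

Record graph (V : finType) := Graph {
  edges :> {set {set V}};
  edges_card2 : [forall e in edges, #|e| == 2]
}.

HB.instance Definition _ (V : finType) := [isSub for @edges V].
HB.instance Definition _ (V : finType) := [Finite of graph V by <:].

(* H occurs in G as a (not necessarily induced) subgraph. *)
Definition contains (W V : finType) (G : graph W) (H : graph V) : bool :=
  [exists f : {ffun V -> W},
     injectiveb f && [forall e in edges H, f @: e \in edges G]].

Definition ex (V : finType) (n : nat) (H : graph V) : nat :=
  \max_(G : graph 'I_n | ~~ contains G H) #|edges G|.

Record bigraph (V : finType) := Bigraph {
  bigraph_graph :> graph V;
  partA : {set V};
  partB : {set V};
  parts_cover : partA :|: partB = [set: V];
  parts_disjoint : [disjoint partA & partB];
  parts_edges : forall e, e \in edges bigraph_graph ->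
    exists2 a, a \in partA & exists2 b, b \in partB & e = [set a; b]
}.

Section Theta.
Variable p : nat.

(* inl false and inl true are the two joined vertices; inr (i, b) is the
   internal vertex of the i-th path that is adjacent to inl b. *)
Definition theta3_vertex : finType := (bool + 'I_p * bool)%type.

Definition theta3_end (b : bool) : theta3_vertex := inl b.
Definition theta3_inner (i : 'I_p) (b : bool) : theta3_vertex := inr (i, b).

Definition theta3_edges : {set {set theta3_vertex}} :=
  \bigcup_(i < p)
    [set [set theta3_end false; theta3_inner i false];
         [set theta3_inner i false; theta3_inner i true];
         [set theta3_inner i true; theta3_end true]].

Definition theta3_partA : {set theta3_vertex} :=
  theta3_end false |: [set theta3_inner i true | i : 'I_p].
Definition theta3_partB : {set theta3_vertex} :=
  theta3_end true |: [set theta3_inner i false | i : 'I_p].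

Lemma theta3_edges_card2 : [forall e in theta3_edges, #|e| == 2].
Proof.
apply/forall_inP => e /bigcupP[i _].
rewrite !inE => /orP[/orP[]|] /eqP->; rewrite cards2 //.
by rewrite (inj_eq inr_inj) xpair_eqE andbF.
Qed.

Lemma theta3_inner_partA i : theta3_inner i true \in theta3_partA.
Proof. by rewrite inE; apply/orP; right; apply/imsetP; exists i. Qed.

Lemma theta3_inner_partB i : theta3_inner i false \in theta3_partB.
Proof. by rewrite inE; apply/orP; right; apply/imsetP; exists i. Qed.

Lemma theta3_parts_cover : theta3_partA :|: theta3_partB = [set: theta3_vertex].
Proof.
apply/setP => -[[]|[i []]]; rewrite in_setT in_setU.
- by rewrite setU11 orbT.
- by rewrite setU11.
- by rewrite theta3_inner_partA.
- by rewrite theta3_inner_partB orbT.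
Qed.

Lemma theta3_parts_disjoint : [disjoint theta3_partA & theta3_partB].
Proof.
apply/pred0P => x /=; apply/negP; rewrite !inE.
by move=> /andP[/orP[/eqP->|/imsetP[i _ ->]] /orP[/eqP //|/imsetP[j _ //]]].
Qed.

Lemma theta3_parts_edges e : e \in theta3_edges ->
  exists2 a, a \in theta3_partA & exists2 b, b \in theta3_partB & e = [set a; b].
Proof.
have inA := theta3_inner_partA; have inB := theta3_inner_partB.
move=> /bigcupP[i _]; rewrite !inE => /orP[/orP[]|] /eqP->.
- by exists (theta3_end false); [rewrite setU11 | exists (theta3_inner i false)].
- by exists (theta3_inner i true) => //; exists (theta3_inner i false);
    rewrite // setUC.
- by exists (theta3_inner i true) => //; exists (theta3_end true);
    rewrite ?setU11.
Qed.

(* The choice of the ordered pair of parts is immaterial: (i, b) |-> (i, ~~ b),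
   b |-> ~~ b is an automorphism exchanging them. *)
Definition theta3 : bigraph theta3_vertex :=
  @Bigraph _ (Graph theta3_edges_card2) theta3_partA theta3_partB
    theta3_parts_cover theta3_parts_disjoint theta3_parts_edges.

End Theta.

Section Extension.
Variables (V : finType) (t : nat) (H : bigraph V).

(* inl x is the vertex x of H, inr None is the new vertex u, and
   inr (Some (a, j)) is the (j+1)-st vertex after u on the path from u to a. *)
Definition L_vertex : finType :=
  (V + option ({a : V | a \in partA H} * 'I_(t - 2)))%type.

(* For 2 <= t, L_path a 0, ..., L_path a t.-1 are the successive vertices of the
   path of length t.-1 from u to a. *)
Definition L_path (a : {a : V | a \in partA H}) (k : nat) : L_vertex :=
  if k is j.+1 then
    if insub j is Some i then inr (Some (a, i)) else inl (val a)
  else inr None.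

Definition L_edges : {set {set L_vertex}} :=
  [set inl @: (e : {set V}) | e in edges H] :|:
  \bigcup_(a : {a : V | a \in partA H})
    [set [set L_path a k; L_path a k.+1] | k : 'I_(t.-1)].

Lemma L_edges_card2 : [forall e in L_edges, #|e| == 2].
Proof.
apply/forall_inP => e; rewrite inE => /orP[/imsetP[e' e'H ->]|].
  by rewrite card_imset; [exact: (forall_inP (edges_card2 H)) | exact: inl_inj].
move=> /bigcupP[a _ /imsetP[[k kt] _ ->]] /=; rewrite cards2.
case: k kt => [|k] kt /=; first by case: insub.
have kt2 : k < t - 2 by case: t kt => [|[|t']] //; rewrite !subSS subn0.
rewrite (insubT (fun j => j < t - 2) kt2).
case: insubP => [j _ jE|//].
rewrite (inj_eq inr_inj) (inj_eq Some_inj) xpair_eqE eqxx /=.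
by rewrite -val_eqE /= jE neq_ltn ltnSn.
Qed.

Definition L : graph L_vertex := Graph L_edges_card2.

End Extension.

Arguments L {V} t H.

(* Main.v *)
(** Let [G] be an [L_3(theta_{3,p})]-free graph on [m] vertices, almost regular
    of degree about [d].  Call a pair of vertices heavy if it has at least [q]
    common neighbours.  Among the 2-walks from any vertex [u], only a small
    fraction have heavy endpoints, since otherwise one builds
    [L_3(theta_{3,p})] greedily inside the heavy pairs.  Hence about [d^3] walks
    [u s w y] have both [(u, w)] and [(s, y)] light.  Choosing for each [w] one
    parent [s] gives a bipartite graph [B] of about [d^3] edges between the at
    most [O(d^2)] vertices [w] and the vertices [y].  Colour each [w] by its
    parent; then every [y] has fewer than [q] neighbours of each colour, and a
    [theta_{3,p}] in [B] whose A-vertices have distinct colours, together with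
    [u] and these colours, is an [L_3(theta_{3,p})].  Counting the walks
    [x v w y] in [B], of which there are at least a constant times
    [e(B)^3 / (d^2 m)], shows that one exists unless [d^5 = O(m^2)].

    For an arbitrary graph, take a smallest vertex set [S] with
    [e(S)^a > C |S|^(a + b)].  By minimality few edges of [S] meet the vertices
    of large degree; deleting these and then the vertices of small degree leaves
    an almost regular subgraph, to which a bound [d^a = O(m^b)] applies; here
    [a = 5] and [b = 2]. *)

Require Import Defs.
From mathcomp Require Import all_boot all_order all_algebra.
From mathcomp Require Import all_classical all_reals all_analysis.
From mathcomp Require Import fintype finset zify ring lra.

Set Implicit Arguments.
Unset Strict Implicit.
Unset Printing Implicit Defensive.

Local Open Scope nat_scope.

(** * Counting and greedy choice *)

Lemma leq_card_fibres (X Y : finType) (f : X -> Y) (A : {set X}) (S : {set Y}) k :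
    {in A, forall x, f x \in S} ->
    {in S, forall y, #|[set x in A | f x == y]| <= k} ->
  #|A| <= #|S| * k.
Proof.
move=> AS Sk; rewrite -sum1_card (partition_big f (mem S)) //= -sum_nat_const.
by apply: leq_sum => y yS; rewrite sum1dep_card Sk.
Qed.

Lemma leq_card_inhabited (X : finType) (A : {set X}) k :
  {in A, forall x, #|A| <= k} -> #|A| <= k.
Proof. by have [->|[x /[swap] /[apply]]] := set_0Vmem A; rewrite ?cards0. Qed.

Lemma leq_card_surj (X Y : finType) (h : X -> Y) (A : {set X}) (B : {set Y}) :
  {in B, forall y, exists2 x, x \in A & y = h x} -> #|B| <= #|A|.
Proof.
move=> BA; apply: leq_trans (leq_imset_card h _); apply: subset_leq_card.
by apply/subsetP => y /BA[x xA ->]; apply: imset_f.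
Qed.

Lemma leq_card_image_ord (X : finType) n (f : 'I_n -> X) : #|f @: setT| <= n.
Proof. by apply: leq_trans (leq_imset_card _ _) _; rewrite cardsT card_ord. Qed.

Lemma leq_card_setU1_image_ord (X : finType) n x (f : 'I_n -> X) :
  #|x |: f @: setT| <= n.+1.
Proof. by rewrite cardsU1 -add1n leq_add ?leq_b1 ?leq_card_image_ord. Qed.

Lemma card_chains_le (X Y Z : finType) (S : {set X}) (F : X -> {set Y})
    (G : Y -> {set Z}) k d :
    {in S, forall x, #|F x| <= k} -> (forall y, #|G y| <= d) ->
  #|[set a : X * Y * Z | [&& a.1.1 \in S, a.1.2 \in F a.1.1 & a.2 \in G a.1.2]]| <=
    #|S| * (k * d).
Proof.
move=> Fk Gd; apply: (leq_card_fibres (f := fun a => a.1.1)) => [a|x xS].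
  by rewrite inE => /and3P[].
apply: leq_trans (_ : #|F x| * d <= _); last by rewrite leq_mul2r Fk ?orbT.
apply: (leq_card_fibres (f := fun a => a.1.2)) => [a|y _].
  by rewrite !inE => /andP[/and3P[_ aF _] /eqP<-].
apply: leq_trans (Gd y); apply: (leq_card_surj (h := pair (x, y))) => -[[x' y'] z].
rewrite !inE /= => /andP[/andP[/and3P[_ _ zG] /eqP<-] /eqP<-].
by exists z.
Qed.

Lemma exists_compatible (Z : finType) (conf : rel Z) (A S : {set Z}) k :
    {in S, forall z, #|[set a in A | conf z a]| <= k} -> #|S| * k < #|A| ->
  exists2 a, a \in A & {in S, forall z, ~~ conf z a}.
Proof.
move=> Sk SA; pose bad := [set a in A | [exists z in S, conf z a]].
have bad_le : #|bad| <= #|S| * k.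
  pose pairs := [set za : Z * Z | [&& za.1 \in S, za.2 \in A & conf za.1 za.2]].
  apply: leq_trans (_ : #|pairs| <= _).
    apply: (leq_card_surj (h := snd)) => a; rewrite inE => /andP[aA].
    by move=> /exists_inP[z zS za]; exists (z, a); rewrite ?inE ?zS ?aA.
  apply: (leq_card_fibres (f := fst)) => [za|z zS].
    by rewrite inE => /and3P[].
  apply: leq_trans (Sk z zS); apply: (leq_card_surj (h := pair z)) => -[z' a].
  rewrite !inE /= => /andP[/and3P[_ aA za] /eqP zz'].
  by exists a; rewrite ?inE ?aA -zz'.
have [a aA abad] : exists2 a, a \in A & a \notin bad.
  by apply/subsetPn; apply: contraTN SA => /subset_leq_card; rewrite -leqNgt; lia.
exists a => // z zS; apply: contra abad => za; rewrite inE aA.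
by apply/exists_inP; exists z.
Qed.

Lemma greedy_independent (I Z : finType) (conf : rel Z) (A : I -> {set Z}) k :
    symmetric conf ->
    (forall i z, #|[set a in A i | conf z a]| <= k) ->
    (forall i, #|I| * k < #|A i|) ->
  exists2 f : I -> Z, forall i, f i \in A i &
    forall i j, i != j -> ~~ conf (f i) (f j).
Proof.
move=> confC confk Ak; have [I0|I_gt0] := posnP #|I|.
  have noI (i : I) : False by have := card0_eq I0 i.
  by exists (fun i => match noI i with end) => i; case: (noI i).
have [i0 _] := card_gt0P I_gt0.
have [z0 _] : exists z, z \in A i0 by apply/card_gt0P; apply: leq_ltn_trans (Ak i0).
suff [f [fA f_ind]] : exists f : I -> Z, {in enum I, forall i, f i \in A i} /\
    {in enum I &, forall i j, i != j -> ~~ conf (f i) (f j)}.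
  exists f => [i|i j]; first by rewrite fA ?mem_enum.
  by apply: f_ind; rewrite mem_enum.
elim: (enum I) => [|i s [f [fA f_ind]]]; first by exists (fun=> z0).
have [a aA a_ind] : exists2 a, a \in A i & {in f @: s, forall z, ~~ conf z a}.
  apply: exists_compatible (fun z _ => confk i z) (leq_ltn_trans _ (Ak i)).
  rewrite leq_mul2r; apply/orP; right.
  by apply: leq_trans (leq_imset_card _ _) (max_card _).
have s_ind j : j \in s -> ~~ conf (f j) a by move=> js; apply/a_ind/imset_f.
exists (fun j => if j == i then a else f j); split=> [j|j j'].
  by rewrite inE; case: eqP => [->|_] //= /fA.
rewrite !inE; have [->|_] := eqVneq j i; have [->|_] := eqVneq j' i => //=.
- by move=> _ js _; rewrite confC s_ind.
- by move=> js _ _; apply: s_ind.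
- exact: f_ind.
Qed.

Lemma greedy_rainbow (I Z : finType) (C : eqType) (c : Z -> C) (A : I -> {set Z})
    (F : {set Z}) k :
    (forall i y, #|[set z in A i | c z == y]| <= k) ->
    (forall i, #|F| + #|I| * k < #|A i|) ->
  exists f : I -> Z, [/\ forall i, f i \in A i, forall i, f i \notin F &
    injective (c \o f)].
Proof.
move=> Ak Alarge.
have [||i|f fA f_ind] :=
    @greedy_independent I Z [rel a b | c a == c b] (fun i => A i :\: F) k.
- by move=> a b /=; rewrite eq_sym.
- move=> i z; apply: leq_trans (Ak i (c z)); apply: subset_leq_card.
  by apply/subsetP => a; rewrite !inE eq_sym => /andP[/andP[_ ->]].
- have := cardsD (A i) F; have := subset_leq_card (subsetIr (A i) F).
  by have := Alarge i; lia.
exists f; split=> [i|i|i j /= /eqP cij]; try by have /setDP[] := fA i.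
by apply/eqP; apply: contraTT cij; apply: f_ind.
Qed.

Lemma distinct_representatives (I Z : finType) (A : I -> {set Z}) (F : {set Z}) :
    (forall i, #|F| + #|I| < #|A i|) ->
  exists f : I -> Z,
    [/\ forall i, f i \in A i, forall i, f i \notin F & injective f].
Proof.
move=> Alarge; apply: (greedy_rainbow (c := id) (k := 1)) => i.
  move=> z; rewrite -(cards1 z); apply/subset_leq_card/subsetP => a.
  by rewrite !inE => /andP[].
by rewrite muln1.
Qed.

Lemma injection_of_leq_card (X : finType) (A : {set X}) n : n <= #|A| ->
  exists2 f : 'I_n -> X, injective f & forall i, f i \in A.
Proof.
move=> nA; exists (fun i => enum_val (widen_ord nA i)) => [i j|i].
  by move/enum_val_inj/(congr1 val) => /= /val_inj.
exact: enum_valP.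
Qed.

(** * Copies of graphs in relations *)

Definition arcs (T : finType) (g : rel T) : {set T * T} := [set e | g e.1 e.2].

Definition rel_edges (T : finType) (g : rel T) : {set {set T}} :=
  [set [set e.1; e.2] | e in arcs g].

Definition has_copy (T V : finType) (g : rel T) (H : graph V) : Prop :=
  exists2 f : V -> T, injective f &
    {in edges H, forall e : {set V}, f @: e \in rel_edges g}.

(* Unlike in [has_copy], [B] need not be symmetric: it relates images of [partA]
   to images of [partB]. *)
Definition bip_copy (T V : finType) (B : rel T) (H : bigraph V) (f : V -> T) :
    Prop :=
  injective f /\
  {in partA H & partB H, forall a b, [set a; b] \in edges H -> B (f a) (f b)}.

Definition nbr (T : finType) (g : rel T) (a : T) : {set T} := [set b | g a b].

Definition codeg (T : finType) (g : rel T) (a b : T) : nat :=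
  #|nbr g a :&: nbr g b|.

Lemma in_nbr (T : finType) (g : rel T) a b : (b \in nbr g a) = g a b.
Proof. by rewrite inE. Qed.

Lemma irreflexive_neq (T : eqType) (g : rel T) a b :
  irreflexive g -> g a b -> a != b.
Proof. by move=> gI gab; apply: contraTneq gab => ->; rewrite gI. Qed.

Lemma rel_edgesP (T : finType) (g : rel T) a b :
  g a b -> [set a; b] \in rel_edges g.
Proof. by move=> gab; apply/imsetP; exists (a, b); rewrite ?inE. Qed.

Lemma card_arcs (T : finType) (B : rel T) : #|arcs B| = \sum_w #|nbr B w|.
Proof.
rewrite -sum1_card (eq_bigl (fun e => B e.1 e.2)) => [|e]; last by rewrite inE.
rewrite -(pair_big_dep xpredT B (fun _ _ => 1)) /=; apply: eq_bigr => w _.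
by rewrite sum1dep_card.
Qed.

Lemma has_copy_map (T T' V : finType) (h : T' -> T) (g : rel T) (H : graph V) :
  injective h -> has_copy (relpre h g) H -> has_copy g H.
Proof.
move=> h_inj [f f_inj f_edge]; exists (h \o f) => [|e eH]; first exact: inj_comp.
rewrite imset_comp; have /imsetP[[a b]] := f_edge e eH.
by rewrite inE /= => gab ->; rewrite imsetU1 imset_set1 rel_edgesP.
Qed.

Section L3Copies.
Variables (T V : finType) (g : rel T) (H : bigraph V) (f : V -> T) (u : T).
Hypotheses (gC : symmetric g) (gI : irreflexive g).
Hypothesis f_copy : bip_copy g H f.
Hypothesis f_neq_u : forall x, f x != u.

Lemma L3_has_copy (s : {a | a \in partA H} -> T) :
    injective s -> (forall a, g u (s a)) -> (forall a, g (s a) (f (val a))) ->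
    (forall a x, f x != s a) ->
  has_copy g (L 3 H).
Proof.
move=> s_inj gus gsf fs; have [f_inj f_edge] := f_copy.
have us a : u != s a := irreflexive_neq gI (gus a).
pose h (z : L_vertex 3 H) : T :=
  match z with
  | inl x => f x
  | inr None => u
  | inr (Some (a, _)) => s a
  end.
exists h => [|e].
  move=> [x|[[a i]|]] [x'|[[a' i']|]] //=.
  - by move/f_inj->.
  - by move/eqP; rewrite (negPf (fs _ _)).
  - by move/eqP; rewrite (negPf (f_neq_u _)).
  - by move/esym/eqP; rewrite (negPf (fs _ _)).
  - by move/s_inj->; rewrite (ord1 i) (ord1 i').
  - by move/esym/eqP; rewrite (negPf (us _)).
  - by move/esym/eqP; rewrite (negPf (f_neq_u _)).
  - by move/eqP; rewrite (negPf (us _)).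
rewrite inE => /orP[/imsetP[e' e'H ->]|].
  have [a aA [b bB e'E]] := parts_edges e'H.
  by rewrite -imset_comp e'E imsetU1 imset_set1 rel_edgesP //= f_edge // -e'E.
move=> /bigcupP[a _ /imsetP[[k lt_k] _ ->]]; rewrite imsetU1 imset_set1.
apply: rel_edgesP; case: k lt_k => [|[|k]] //= _.
  by case: insubP => [i _ _|//]; apply: gus.
case: insubP => [i _ _|//]; case: insubP => [i' i'_lt _|_] //; exact: gsf.
Qed.

Lemma L3_has_copy_of_codeg :
    {in partA H, forall a, #|V| + #|partA H| < codeg g u (f a)} ->
  has_copy g (L 3 H).
Proof.
move=> f_codeg; have [a|s [sP sf s_inj]] :=
  @distinct_representatives {a | a \in partA H} T
    (fun a => nbr g u :&: nbr g (f (val a))) (f @: setT).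
  apply: leq_ltn_trans (f_codeg _ (valP a)); rewrite card_sig leq_add2r.
  by rewrite -cardsT leq_imset_card.
apply: (L3_has_copy s_inj) => [a|a|a x].
- by have := sP a; rewrite !inE => /andP[].
- by have := sP a; rewrite !inE (gC (s a)) => /andP[].
- by apply: contraNneq (sf a) => <-; rewrite imset_f.
Qed.

End L3Copies.

Section ThetaCopies.
Variables (T : finType) (B : rel T) (p : nat) (x y : T) (v w : 'I_p -> T).
Hypothesis BI : irreflexive B.

Definition theta3_map (z : theta3_vertex p) : T :=
  match z with
  | inl b => if b then y else x
  | inr (i, b) => if b then w i else v i
  end.

Lemma theta3_bip_copy :
    (forall i, [/\ B x (v i), B (w i) (v i) & B (w i) y]) ->
    injective v -> injective w -> x != y -> (forall i, x != w i) ->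
    (forall i, v i != y) -> (forall i j, v i != w j) ->
  bip_copy B (theta3 p) theta3_map.
Proof.
move=> Bvw v_inj w_inj xy xw vy vw.
have xv i : x != v i by have [Bxv _ _] := Bvw i; apply: irreflexive_neq BI Bxv.
have wy i : w i != y by have [_ _ Bwy] := Bvw i; apply: irreflexive_neq BI Bwy.
split.
  have neqs := (xy, xw, vy, vw, xv, wy).
  move=> [[]|[i []]] [[]|[j []]] //= eq_z; do ?[by rewrite (v_inj _ _ eq_z)
    | by rewrite (w_inj _ _ eq_z)];
    by exfalso; move/eqP: eq_z; apply/negP; rewrite ?neqs // eq_sym neqs.
move=> a b aA bB /bigcupP[i _] abE.
have [Bxv Bwv Bwy] := Bvw i; rewrite !in_setU !in_set1 in abE.
have := set22 a b; have := set21 a b.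
by move: abE => /orP[/orP[]|] /eqP->; rewrite !inE;
  move=> /orP[]/eqP aE /orP[]/eqP bE; move: aA bB; rewrite aE bE !inE;
  do 2![move=> /orP[/eqP // _|/imsetP[? _] // _]].
Qed.

End ThetaCopies.

(** * Walks with three edges *)

Section ThreeEdgeWalks.
Import Order.TTheory GRing.Theory Num.Theory.
Local Open Scope ring_scope.

Lemma ge3_sum_of_mul_eq1 (F : realFieldType) (x y z : F) :
  0 < x -> 0 < y -> 0 < z -> x * y * z = 1 -> 3 <= x + y + z.
Proof.
move=> x0 y0 z0 xyz1.
have [|AGM _] := @leif_AGM_scaled F 'I_3 predT (fun i => [:: x; y; z]`_i).
  by case=> [[|[|[|]]] //=] *; rewrite mulrn_wge0 ?ltW.
rewrite cardT size_enum_ord !big_ord_recl !big_ord0 /= addr0 addrA mulr1 in AGM.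
have : 3 ^+ 3 <= (x + y + z) ^+ 3 by lra.
by rewrite ler_pXn2r ?nnegrE ?addr_ge0 // ltW.
Qed.

Lemma sum_inv_card_fibre (X Y : finType) (f : X -> Y) (Q : {set X}) :
  \sum_(x in Q) #|[set z in Q | f z == f x]|%:R^-1 = #|f @: Q|%:R :> rat.
Proof.
rewrite (partition_big_imset f) /= -sum1_card natr_sum.
apply: eq_bigr => y /imsetP[x xQ ->].
under eq_bigr => z /andP[_ /eqP->] do idtac.
rewrite sumr_const -(cardsE [pred z in Q | f z == f x]) -[_ *+ _]mulr_natr.
rewrite mulVf // pnatr_eq0.
by rewrite -lt0n card_gt0; apply/set0Pn; exists x; rewrite inE xQ eqxx.
Qed.

(* With [d] and [d'] the sizes of the two fibres of [x], and [a] and [a'] their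
   averages, this is the sum over [x] of [3 <= d d' / (a a') + a / d + a' / d']. *)
Lemma card_cube_le_walks (X Y Z : finType) (f : X -> Y) (h : X -> Z) (Q : {set X}) :
  (#|Q| ^ 3 <= #|f @: Q| * #|h @: Q| * \sum_(x in Q)
     #|[set z in Q | f z == f x]| * #|[set z in Q | h z == h x]|)%N.
Proof.
have [->|/set0Pn[x0 x0Q]] := eqVneq Q set0; first by rewrite cards0.
have card_gt0 (W : finType) (A : {set W}) w : w \in A -> 0 < #|A|%:R :> rat.
  by move=> wA; rewrite ltr0n card_gt0; apply/set0Pn; exists w.
have e_gt0 := card_gt0 _ _ _ x0Q.
have m_gt0 := card_gt0 _ _ _ (imset_f f x0Q).
have n_gt0 := card_gt0 _ _ _ (imset_f h x0Q).
set e : rat := #|Q|%:R in e_gt0; set m : rat := #|f @: Q|%:R in m_gt0.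
set n : rat := #|h @: Q|%:R in n_gt0.
pose d x : rat := #|[set z in Q | f z == f x]|%:R.
pose d' x : rat := #|[set z in Q | h z == h x]|%:R.
have AGM x : x \in Q ->
    3 <= d x * d' x * (m * n / e ^+ 2) + (d x)^-1 * (e / m) + (d' x)^-1 * (e / n).
  move=> xQ; have d_gt0 : 0 < d x by apply: (card_gt0 _ _ x); rewrite inE xQ /=.
  have d'_gt0 : 0 < d' x by apply: (card_gt0 _ _ x); rewrite inE xQ /=.
  apply: ge3_sum_of_mul_eq1; rewrite ?mulr_gt0 ?invr_gt0 ?exprn_gt0 //.
  by field; rewrite !gt_eqF.
have := ler_sum (index_enum X) AGM; rewrite sumr_const -[X in X <= _]mulr_natr -/e.
rewrite !big_split /= -!mulr_suml !sum_inv_card_fibre -/m -/n.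
rewrite !(mulrC _ (e / _)) !divfK ?gt_eqF // => sum_ge.
rewrite -(ler_nat rat) natrX !natrM natr_sum -/e -/m -/n.
under eq_bigr do rewrite natrM -/(d _) -/(d' _).
have : e <= (\sum_(x in Q) d x * d' x) * (m * n / e ^+ 2) by lra.
by rewrite mulrA ler_pdivlMr ?exprn_gt0 // -exprS mulrC.
Qed.

End ThreeEdgeWalks.

(** * Rainbow copies of theta graphs *)

Definition theta3_codeg (p q : nat) : nat := q * p.+1 + p.*2 + 2.

Definition theta3_const (p q : nat) : nat := p.+1 * (q + 3) * theta3_codeg p q.

Section RainbowTheta.
Variables (T : finType) (C : eqType) (B : rel T) (c : T -> C) (p q d : nat).
Let ins y : {set T} := [set x | B x y].
Let outs x : {set T} := [set y | B x y].
Let r := theta3_codeg p q.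

Hypothesis BI : irreflexive B.
Hypothesis colour_le : forall y z, #|[set x in ins y | c x == z]| <= q.
Hypothesis indegree_le : forall y, #|ins y| <= d.
Hypothesis outdegree_le : forall x, #|outs x| <= d.
Hypothesis no_rainbow_copy : forall f, bip_copy B (theta3 p) f ->
  ~ {in partA (theta3 p) &, injective (c \o f)}.

Lemma no_rainbow_theta3 x y (v w : 'I_p -> T) :
    (forall i, [/\ B x (v i), B (w i) (v i) & B (w i) y]) ->
    injective v -> injective (c \o w) -> x != y -> (forall i, c (w i) != c x) ->
    (forall i, v i != y) -> (forall i j, v i != w j) ->
  False.
Proof.
move=> Bvw v_inj cw_inj xy cwx vy vw.
apply: (no_rainbow_copy (f := theta3_map x y v w)).
  apply: theta3_bip_copy => // [i j wij|i]; first by apply: cw_inj; rewrite /= wij.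
  by apply: contraNneq (cwx i) => ->.
move=> a b; rewrite !inE.
move=> /orP[/eqP->|/imsetP[i _ ->]] /orP[/eqP->|/imsetP[j _ ->]] //=.
- by move/esym/eqP; rewrite (negPf (cwx j)).
- by move/eqP; rewrite (negPf (cwx i)).
- by move/cw_inj->.
Qed.

Lemma few_rich_right w y : B w y ->
  #|[set v in outs w | (v != y) && (r <= #|ins v :&: ins y|)]| <= p.
Proof.
move=> Bwy; apply: ltnW; rewrite ltnNge.
apply/negP => /injection_of_leq_card[v v_inj vP].
have {}vP i : [/\ B w (v i), v i != y & r <= #|ins (v i) :&: ins y|].
  by have := vP i; rewrite 2!inE => /andP[? /andP[]].
pose F : {set T} := [set x in ins y | c x == c w] :|: v @: setT.
have F_le : #|F| <= q + p.
  by rewrite cardsU; have := colour_le y (c w); have := leq_card_image_ord v; lia.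
have [i z|i|f [fP fF cf_inj]] :=
  greedy_rainbow (c := c) (A := fun i => ins (v i) :&: ins y) (F := F) (k := q).
- apply: leq_trans (colour_le y z); apply: subset_leq_card.
  by apply/subsetP => x; rewrite !inE => /andP[/andP[_ ->] ->].
- have [_ _] := vP i; apply: leq_trans; rewrite card_ord /r /theta3_codeg; lia.
have {}fP i : [/\ B (f i) (v i), B (f i) y & c (f i) != c w].
  have := fP i; have := fF i; rewrite !inE negb_or => /andP[fcw _] /andP[-> fy].
  by rewrite fy in fcw *.
apply: (no_rainbow_theta3 (x := w) (y := y) (v := v) (w := f)) => // [i||i|i|i j].
- by have [Bwv _ _] := vP i; have [Bfv Bfy _] := fP i.
- exact: irreflexive_neq BI _.
- by have [] := fP i.
- by have [] := vP i.
- by apply: contraNneq (fF j) => <-; rewrite inE orbC imset_f.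
Qed.

Lemma few_rich_left x v : B x v ->
  #|[set w in ins v | (c w != c x) && (r <= #|outs x :&: outs w|)]| <= q * p.
Proof.
move=> Bxv; rewrite leqNgt; apply/negP; set A := [set w in _ | _] => A_large.
have [i z|i|f [fP _ cf_inj]] :=
  greedy_rainbow (c := c) (A := fun _ : 'I_p => A) (F := set0) (k := q).
- apply: leq_trans (colour_le v z); apply: subset_leq_card.
  by apply/subsetP => w; rewrite !inE => /andP[/andP[-> _] ->].
- by rewrite cards0 card_ord mulnC.
have {}fP i : [/\ B (f i) v, c (f i) != c x & r <= #|outs x :&: outs (f i)|].
  by have := fP i; rewrite 2!inE => /andP[? /andP[? ?]]; split.
have [i|h [hP hF h_inj]] := distinct_representatives
    (A := fun i => outs x :&: outs (f i)) (F := v |: f @: setT).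
  have [_ _] := fP i; apply: leq_trans; rewrite card_ord /r /theta3_codeg.
  have := leq_card_setU1_image_ord v f; lia.
apply: (no_rainbow_theta3 (x := x) (y := v) (v := h) (w := f)) => // [i||i|i|i j].
- by have := hP i; have [Bfv _ _] := fP i; rewrite !inE => /andP[].
- exact: irreflexive_neq BI _.
- by have [] := fP i.
- by apply: contraNneq (hF i) => ->; rewrite setU11.
- by apply: contraNneq (hF i) => ->; rewrite !inE orbC imset_f.
Qed.

Definition light_inner x y : {set T * T} :=
  [set a | [&& B x a.1, B a.2 a.1, B a.2 y, a.1 != y, c a.2 != c x,
     #|ins a.1 :&: ins y| < r & #|outs x :&: outs a.2| < r]].

Lemma light_innerP x y a : a \in light_inner x y ->
  [/\ B x a.1, B a.2 a.1 & B a.2 y] /\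
  [/\ a.1 != y, c a.2 != c x, #|ins a.1 :&: ins y| < r &
    #|outs x :&: outs a.2| < r].
Proof. by rewrite inE => /and5P[? ? ? ? /and3P[? ? ?]]; do 2?split. Qed.

Lemma few_light_inner_fst x y v : #|[set a in light_inner x y | a.1 == v]| <= r.
Proof.
apply: leq_card_inhabited => a0.
move=> /setIdP[/light_innerP[_ [_ _ v_light _]] /eqP a0v]; rewrite a0v in v_light.
apply: leq_trans (ltnW v_light); apply: (leq_card_surj (h := pair v)) => -[v' w].
move=> /setIdP[/light_innerP[[_ wv wy] _] /eqP /= v'v]; subst v'.
by exists w; rewrite // !inE wv.
Qed.

Lemma few_light_inner_snd x y w : #|[set a in light_inner x y | a.2 == w]| <= r.
Proof.
apply: leq_card_inhabited => a0.
move=> /setIdP[/light_innerP[_ [_ _ _ w_light]] /eqP a0w]; rewrite a0w in w_light.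
apply: leq_trans (ltnW w_light); apply: (leq_card_surj (h := pair^~ w)) => -[v w'].
move=> /setIdP[/light_innerP[[xv wv _] _] /eqP /= w'w]; subst w'.
by exists v; rewrite // !inE xv.
Qed.

Lemma few_light_inner_colour x y z :
  #|[set a in light_inner x y | c a.2 == z]| <= q * r.
Proof.
apply: leq_trans (_ : #|[set w in ins y | c w == z]| * r <= _); last first.
  by rewrite leq_mul2r colour_le orbT.
apply: (leq_card_fibres (f := snd)) => [a|w _].
  by move=> /setIdP[/light_innerP[[_ _ wy] _] cw]; rewrite !inE wy.
apply: leq_trans (few_light_inner_snd x y w); apply: subset_leq_card.
by apply/subsetP => a; rewrite !inE => /andP[/andP[-> _] ->].
Qed.

Lemma card_light_inner x y : x != y -> #|light_inner x y| <= theta3_const p q.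
Proof.
move=> xy; set L := light_inner x y; rewrite leqNgt; apply/negP => L_large.
pose conf : rel (T * T) := fun a b =>
  [|| a.1 == b.1, c a.2 == c b.2, a.1 == b.2 | a.2 == b.1].
have [||i|f fL f_ind] :=
    @greedy_independent 'I_p _ conf (fun=> L) ((q + 3) * r).
- move=> a b; rewrite /conf (eq_sym a.1) (eq_sym (c a.2)) (eq_sym a.1) (eq_sym a.2).
  by congr [|| _, _ | _]; rewrite orbC.
- move=> _ a; pose S (P : pred (T * T)) := [set b in L | P b].
  have conf_sub : S (conf a) \subset
      S (fun b => b.1 == a.1) :|: (S (fun b => c b.2 == c a.2) :|:
        (S (fun b => b.2 == a.1) :|: S (fun b => b.1 == a.2))).
    apply/subsetP => b; rewrite [b \in S _]inE /conf => /andP[bL ab].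
    have inS P : (b \in S P) = P b by rewrite inE bL.
    by move: ab; rewrite !in_setU !inS !(eq_sym b.1) !(eq_sym b.2) (eq_sym (c b.2)).
  apply: leq_trans (subset_leq_card conf_sub) _; rewrite !cardsU mulnDl.
  have := few_light_inner_fst x y a.1; have := few_light_inner_fst x y a.2.
  have := few_light_inner_snd x y a.1; have := few_light_inner_colour x y (c a.2).
  rewrite /S -/L; lia.
- move: L_large; rewrite card_ord /theta3_const -mulnA mulSn.
  by apply: leq_ltn_trans; rewrite leq_addl.
have {}fL i := light_innerP (fL i).
have f_neq i j : i != j -> [/\ (f i).1 != (f j).1, c (f i).2 != c (f j).2 &
    (f i).1 != (f j).2].
  by move/f_ind; rewrite !negb_or => /and4P[].
apply: (no_rainbow_theta3 (x := x) (y := y) (v := fst \o f) (w := snd \o f)) => //=.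
- by move=> i; have [] := fL i.
- by move=> i j /eqP fij; apply/eqP; apply: contraTT fij => /f_neq[].
- by move=> i j /eqP fij; apply/eqP; apply: contraTT fij => /f_neq[].
- by move=> i; have [_ []] := fL i.
- by move=> i; have [_ []] := fL i.
- move=> i j; have [<-|/f_neq[] //] := eqVneq i j.
  by have [[_ Bwv _] _] := fL i; rewrite eq_sym (irreflexive_neq BI).
Qed.

Definition walks3 : {set (T * T) * (T * T)} :=
  [set a | [&& B a.1.1 a.1.2, B a.2.1 a.1.2 & B a.2.1 a.2.2]].

Lemma card_arcs_cube_le : #|arcs B| ^ 3 <= #|fst @: arcs B| * #|T| * #|walks3|.
Proof.
have := card_cube_le_walks fst snd (arcs B) => /leq_trans; apply; apply: leq_mul.
  by rewrite leq_mul2l max_card orbT.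
rewrite -sum1_card (partition_big (fun a => (a.2.1, a.1.2)) (mem (arcs B))) /=;
  last by move=> [[x v] [w y]]; rewrite !inE /= => /and3P[].
apply: leq_sum => -[w v]; rewrite inE /= => Bwv; rewrite sum1dep_card mulnC -cardsX.
apply/subset_leq_card/subsetP => -[[x v'] [w' y]].
rewrite !inE /= => /andP[/andP[xv /eqP v'v] /andP[wy /eqP w'w]].
by subst v' w'; rewrite xv Bwv wy eqxx.
Qed.

Lemma card_closed_walks3 : #|[set a in walks3 | a.1.1 == a.2.2]| <= #|arcs B| * d.
Proof.
apply: (leq_card_fibres (f := fst)) => [a|[x v] _].
  by move=> /setIdP[]; rewrite !inE => /and3P[].
apply: leq_trans (indegree_le v).
apply: (leq_card_surj (h := fun w => ((x, v), (w, x)))).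
move=> [[x' v'] [w y]] /setIdP[/setIdP[]]; rewrite inE /= => /and3P[_ Bwv _] /eqP->.
by case/eqP=> -> eq_v; exists w; rewrite ?inE -?eq_v.
Qed.

Let rich_right w y : {set T} :=
  [set v in outs w | (v == y) || (r <= #|ins v :&: ins y|)].

Let rich_left x v : {set T} :=
  [set w in ins v | (c w == c x) || (r <= #|outs x :&: outs w|)].

Lemma card_rich_right_walks3 :
  #|[set a in walks3 | a.1.2 \in rich_right a.2.1 a.2.2]| <= #|arcs B| * (p.+1 * d).
Proof.
pose F e := rich_right e.1 e.2.
apply: leq_trans (card_chains_le (F := F) _ indegree_le).
  apply: (leq_card_surj (h := fun a => ((a.2, a.1.2), a.1.1))) => -[[x v] [w y]].
  move=> /setIdP[]; rewrite inE /= => /and3P[Bxv _ Bwy] v_rich.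
  by exists ((w, y), v, x); rewrite // inE /= v_rich !inE /= Bwy.
move=> [w y]; rewrite inE /= => Bwy.
apply: leq_trans (_ :
    #|y |: [set v in outs w | (v != y) && (r <= #|ins v :&: ins y|)]| <= _).
  apply: subset_leq_card; apply/subsetP => v; rewrite !inE.
  by case: eqP => //= _ /andP[-> ->].
by rewrite cardsU1; have := few_rich_right Bwy; case: (_ \notin _) => /=; lia.
Qed.

Lemma card_rich_left_walks3 :
  #|[set a in walks3 | a.2.1 \in rich_left a.1.1 a.1.2]| <=
    #|arcs B| * (q * p.+1 * d).
Proof.
pose F e := rich_left e.1 e.2.
apply: leq_trans (card_chains_le (F := F) _ outdegree_le).
  apply: (leq_card_surj (h := fun a => (a.1.1, (a.1.2, a.2)))) => -[[x v] [w y]].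
  move=> /setIdP[]; rewrite inE /= => /and3P[Bxv _ Bwy] w_rich.
  by exists ((x, v), w, y); rewrite // inE /= w_rich !inE /= Bxv.
move=> [x v]; rewrite inE /= => Bxv.
apply: leq_trans (_ : #|[set w in ins v | c w == c x] :|:
    [set w in ins v | (c w != c x) && (r <= #|outs x :&: outs w|)]| <= _).
  apply: subset_leq_card; apply/subsetP => w; rewrite !inE.
  by case: eqP => /= _ /andP[->].
rewrite cardsU; have := few_rich_left Bxv; have := colour_le v (c x); lia.
Qed.

Lemma card_light_walks3 :
  #|[set a in walks3 | (a.1.1 != a.2.2) &&
      ((a.1.2, a.2.1) \in light_inner a.1.1 a.2.2)]| <=
    #|fst @: arcs B| * #|T| * theta3_const p q.
Proof.
rewrite -cardsT -cardsX; apply: (leq_card_fibres (f := fun a => (a.1.1, a.2.2))).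
  move=> [[x v] [w y]] /setIdP[]; rewrite !inE /= andbT => /and3P[Bxv _ _] _.
  by apply/imsetP; exists (x, v); rewrite ?inE.
move=> [x y] _; apply: leq_card_inhabited => a0.
move=> /setIdP[/setIdP[_ /andP[xy _]] /eqP[a0x a0y]].
rewrite a0x a0y in xy; apply: leq_trans (card_light_inner xy).
apply: (leq_card_surj (h := fun a => ((x, a.1), (a.2, y)))) => -[[x' v] [w y']].
move=> /setIdP[/setIdP[_ /andP[_ vw]] /eqP[/= eq_x eq_y]]; subst x' y'.
by exists (v, w).
Qed.

Lemma card_walks3_le :
  #|walks3| <= theta3_const p q * (#|arcs B| * d + #|fst @: arcs B| * #|T|).
Proof.
have covered : walks3 \subset [set a in walks3 | a.1.1 == a.2.2] :|:
    ([set a in walks3 | a.1.2 \in rich_right a.2.1 a.2.2] :|: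
    ([set a in walks3 | a.2.1 \in rich_left a.1.1 a.1.2] :|:
    [set a in walks3 | (a.1.1 != a.2.2) &&
      ((a.1.2, a.2.1) \in light_inner a.1.1 a.2.2)])).
  apply/subsetP => -[[x v] [w y]]; rewrite !inE /= => /and3P[-> -> ->] /=.
  case: eqP => //= _; case: (v == y) => //=; case: (c w == c x); rewrite ?orbT //=.
  by case: (leqP r #|ins v :&: ins y|) => //=; case: (leqP r #|outs x :&: outs w|).
apply: leq_trans (subset_leq_card covered) _; rewrite !cardsU.
have := card_closed_walks3; have := card_rich_right_walks3.
have := card_rich_left_walks3; have := card_light_walks3.
have const_ge : 1 + p.+1 + q * p.+1 <= theta3_const p q.
  apply: leq_trans (_ : r <= _); first by rewrite /r /theta3_codeg; lia.
  by rewrite leq_pmull // muln_gt0 addn3.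
have := leq_mul const_ge (leqnn (#|arcs B| * d)); lia.
Qed.

Lemma rainbow_theta3_free_bound : #|arcs B| ^ 3 <= #|fst @: arcs B| * #|T| *
    (theta3_const p q * (#|arcs B| * d + #|fst @: arcs B| * #|T|)).
Proof.
by apply: leq_trans card_arcs_cube_le _; rewrite leq_mul2l card_walks3_le orbT.
Qed.

End RainbowTheta.

(** * Heavy pairs *)

Lemma sum_nbr_swap (T : finType) (g : rel T) (A B : {set T}) (F : T -> T -> nat) :
    symmetric g ->
  \sum_(v in A) \sum_(w in nbr g v :&: B) F v w =
  \sum_(w in B) \sum_(v in nbr g w :&: A) F v w.
Proof.
move=> gC; rewrite (exchange_big_dep (mem B)) /=; last by move=> v w _ /setIP[].
apply: eq_bigr => w wB; apply: eq_bigl => v.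
by rewrite !in_setI !in_nbr wB andbT (gC w) andbC.
Qed.

Lemma sum_card_nbr_swap (T : finType) (g : rel T) (A B : {set T}) :
    symmetric g ->
  \sum_(v in A) #|nbr g v :&: B| = \sum_(v in B) #|nbr g v :&: A|.
Proof.
move=> gC; under eq_bigr do rewrite -sum1_card.
by rewrite sum_nbr_swap //; under eq_bigr do rewrite sum1_card.
Qed.

(* Each pair [s], [s'] counted on the left has at most [b] common neighbours [w]. *)
Lemma sum_few_common_nbr_le (T : finType) (g : rel T) (A S : {set T}) b :
    symmetric g ->
  \sum_(w in A) \sum_(s in nbr g w :&: S)
    #|[set s' in nbr g w :&: S | #|nbr g s :&: nbr g s' :&: A| <= b]|
    <= b * #|S| ^ 2.
Proof.
move=> gC.
rewrite -(sum_nbr_swap S A (fun s w => #|[set s' in nbr g w :&: S | _]|)) //.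
rewrite -mulnn mulnCA -sum_nat_const; apply: leq_sum => s _.
rewrite mulnC -sum_nat_const.
apply: leq_trans (_ : \sum_(w in nbr g s :&: A) \sum_(s' in nbr g w :&: S)
    (#|nbr g s :&: nbr g s' :&: A| <= b) <= _).
  apply: leq_sum => w _; rewrite -sum1_card big_mkcond [leqRHS]big_mkcond.
  apply: leq_sum => s' _; rewrite inE.
  by case: (s' \in _); case: (_ <= b).
rewrite sum_nbr_swap //; apply: leq_sum => s' _.
rewrite sum_nat_const setIA (setIC (nbr g s')).
by case: (leqP #|nbr g s :&: nbr g s' :&: A| b) => le_b; rewrite ?muln0 ?muln1.
Qed.

Section HeavyPairs.
Variables (T : finType) (g : rel T) (p : nat).
Hypotheses (gC : symmetric g) (gI : irreflexive g).
Hypothesis no_copy : ~ has_copy g (L 3 (theta3 p)).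

Definition heavy (q : nat) (u : T) : {set T} :=
  [set w | (w != u) && (q <= codeg g u w)].

Definition heavy_walks (q : nat) (u : T) : nat := \sum_(w in heavy q u) codeg g u w.

Lemma no_heavy_theta3 q u (f : theta3_vertex p -> T) :
    3 * p + 4 <= q -> bip_copy g (theta3 p) f -> (forall z, f z != u) ->
  ~ {in partA (theta3 p), forall a, f a \in heavy q u}.
Proof.
move=> pq f_copy f_neq_u f_heavy; apply: no_copy.
apply: (L3_has_copy_of_codeg gC gI f_copy f_neq_u) => a /f_heavy.
rewrite inE => /andP[_]; apply: leq_trans; apply: leq_trans pq.
have partA_le : #|partA (theta3 p)| <= p.+1.
  rewrite cardsU1 -add1n leq_add ?leq_b1 //.
  by apply: leq_trans (leq_imset_card _ _) _; rewrite card_ord.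
by rewrite card_sum card_bool card_prod card_ord card_bool; lia.
Qed.

(* Otherwise [p] such vertices [v i], with [x := w], extend greedily to a heavy
   copy of the theta graph. *)
Lemma few_rich_nbrs q u y w :
    3 * p + 4 <= q -> y != u -> g y w -> w \in heavy q u ->
  #|[set v in nbr g w | [&& v != y, v != u &
      2 * p + 1 < #|nbr g y :&: nbr g v :&: heavy q u|]]| < p.
Proof.
move=> pq yu gyw w_heavy; rewrite ltnNge.
apply/negP => /injection_of_leq_card[v v_inj vP].
have {}vP i : [/\ g w (v i), v i != y, v i != u &
    2 * p + 1 < #|nbr g y :&: nbr g (v i) :&: heavy q u|].
  by have := vP i; rewrite 2!inE => /andP[? /and3P[? ? ?]].
have [i|f [fP fF f_inj]] := distinct_representatives
    (A := fun i => nbr g y :&: nbr g (v i) :&: heavy q u) (F := w |: v @: setT).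
  have [_ _ _] := vP i; apply: leq_ltn_trans; rewrite card_ord.
  have := leq_card_setU1_image_ord w v; lia.
have {}fP i : [/\ g (f i) y, g (f i) (v i) & f i \in heavy q u].
  by have := fP i; rewrite 2!in_setI !in_nbr !(gC (f i)) => /andP[/andP[]].
have heavy_neq z : z \in heavy q u -> z != u by rewrite inE => /andP[].
apply: (no_heavy_theta3 (u := u) (f := theta3_map w y v f) pq).
- apply: theta3_bip_copy => // [i||i|i|i j].
  + by have [] := vP i; have [] := fP i.
  + by rewrite eq_sym (irreflexive_neq gI).
  + by apply: contraNneq (fF i) => ->; rewrite setU11.
  + by have [] := vP i.
  + by apply: contraNneq (fF j) => <-; rewrite !inE orbC imset_f.
- move=> [[]|[i []]] //=; [exact: heavy_neq | | by have [] := vP i].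
  by have [_ _ /heavy_neq] := fP i.
- move=> a; rewrite in_setU1 => /orP[/eqP->|/imsetP[i _ ->]] //=.
  by have [] := fP i.
Qed.

Lemma codeg_le_few_common_nbr q u w s :
    3 * p + 4 <= q -> w \in heavy q u -> s \in nbr g w :&: nbr g u ->
  codeg g u w <= p + #|[set s' in nbr g w :&: nbr g u |
    #|nbr g s :&: nbr g s' :&: heavy q u| <= 2 * p + 1]|.
Proof.
move=> pq w_heavy /setIP[]; rewrite !in_nbr => gws gus.
have := few_rich_nbrs pq (_ : s != u) (_ : g s w) w_heavy.
rewrite eq_sym (irreflexive_neq gI gus) gC => /(_ isT gws).
set R := [set v in nbr g w | _] => Rp.
set P := [set s' in _ | _]; have : nbr g u :&: nbr g w \subset s |: R :|: P.
  apply/subsetP => s'; rewrite !inE => /andP[gus' gws'].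
  rewrite gus' gws' /=; case: eqP => //= _.
  by rewrite (eq_sym s') (irreflexive_neq gI gus') /= ltnNge orNb.
move/subset_leq_card; rewrite /codeg cardsU cardsU1.
by case: (_ \notin _) => /=; lia.
Qed.

Lemma heavy_walks_le q u : 3 * p + 4 <= q ->
  q * heavy_walks q u <= p * heavy_walks q u + (2 * p + 1) * #|nbr g u| ^ 2.
Proof.
move=> pq; apply: leq_trans (_ :
    \sum_(w in heavy q u) \sum_(s in nbr g w :&: nbr g u) codeg g u w <= _).
  rewrite big_distrr; apply: leq_sum => w; rewrite inE => /andP[_ qw] /=.
  by rewrite sum_nat_const setIC leq_mul2r qw orbT.
have := sum_few_common_nbr_le (heavy q u) (nbr g u) (2 * p + 1) gC.
rewrite -(leq_add2l (p * heavy_walks q u)); apply: leq_trans.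
rewrite big_distrr -big_split; apply: leq_sum => w w_heavy /=.
rewrite {2}/codeg (setIC (nbr g u)) mulnC -sum_nat_const -big_split.
by apply: leq_sum => s; exact: codeg_le_few_common_nbr.
Qed.

Lemma heavy_walks_le_degree q K delta u : 3 * p + 4 <= q ->
    p + 8 * (2 * p + 1) * K ^ 3 <= q -> 0 < K -> #|nbr g u| <= K * delta ->
  8 * K * heavy_walks q u <= delta ^ 2.
Proof.
move=> pq q_large K_gt0 degree_le; set b := 2 * p + 1 in q_large.
have bK_gt0 : 0 < b * K ^ 2 by rewrite muln_gt0 expn_gt0 K_gt0 /b addn1.
rewrite -(leq_pmul2l bK_gt0).
have := leq_mul q_large (leqnn (heavy_walks q u)); have := heavy_walks_le u pq.
have : b * #|nbr g u| ^ 2 <= b * (K * delta) ^ 2.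
  by rewrite leq_mul2l leq_exp2r // degree_le orbT.
by rewrite expnMn (expnS K 2) -/b; lia.
Qed.

End HeavyPairs.

(** * Light walks from a vertex *)

Section LightWalks.
Variables (T : finType) (g : rel T) (q : nat) (u : T).
Hypothesis gC : symmetric g.
Local Notation N := (nbr g).

Definition light_mids : {set T} :=
  [set w | [&& w != u, codeg g u w < q & w \notin N u]].

Definition light_ends (s w : T) : {set T} :=
  [set y in N w | (codeg g s y < q) && (y \notin N u)].

Definition light_walks : nat :=
  \sum_(s in N u) \sum_(w in N s :&: light_mids) #|light_ends s w|.

Section DegreeBound.
Variable D : nat.
Hypothesis degree_le : forall v, #|N v| <= D.

Lemma sum_codeg_not_light_mids :
  \sum_(w in ~: light_mids) codeg g u w <= heavy_walks g q u + q.+1 * D.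
Proof.
apply: leq_trans (_ : heavy_walks g q u +
    (\sum_(w | w == u) D + \sum_(w in N u) q) <= _).
  rewrite /heavy_walks !(big_mkcond (fun w => w \in _)).
  rewrite (big_mkcond (fun w => w == u)) -!big_split.
  apply: leq_sum => w _ /=; rewrite !inE.
  have [->|_] /= := eqVneq w u.
    by rewrite /codeg setIid; have := degree_le u; lia.
  by case: (ltnP (codeg g u w) q) => /=; case: (g u w) => //=; lia.
rewrite big_pred1_eq sum_nat_const mulSn leq_add2l leq_add2l mulnC leq_mul2l.
by rewrite degree_le orbT.
Qed.

Lemma sum_not_light_ends :
  \sum_(s in N u) \sum_(w in N s :&: light_mids) #|N w :\: light_ends s w| <=
    \sum_(s in N u) heavy_walks g q s + q * D ^ 2.
Proof.
apply: leq_trans (_ : \sum_(s in N u) (heavy_walks g q s + D * q) <= _); last first.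
  rewrite big_split /= leq_add2l sum_nat_const mulnA mulnC leq_mul2l.
  by rewrite leq_mul ?orbT.
apply: leq_sum => s us.
apply: leq_trans (_ :
    \sum_(w in N s :&: light_mids) (#|N w :&: heavy g q s| + q) <= _).
  apply: leq_sum => w /setIP[_]; rewrite inE => /and3P[_ /ltnW codeg_le _].
  have : N w :\: light_ends s w \subset (N w :&: heavy g q s) :|: (N u :&: N w).
    apply/subsetP => y; rewrite !inE => /andP[+ wy]; rewrite wy andbT /=.
    have [//|uy] := boolP (g u y); rewrite ?orbT // !orbF andbT -leqNgt => ->.
    by rewrite andbT; apply: contraNneq uy => ->; rewrite -in_nbr.
  by move/subset_leq_card; rewrite cardsU -/(codeg g u w); lia.
rewrite big_split /= sum_nat_const; apply: leq_add; last first.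
  rewrite leq_mul2r (leq_trans _ (degree_le s)) ?orbT //.
  by rewrite subset_leq_card // subsetIl.
rewrite sum_card_nbr_swap //; apply: leq_sum => y _.
by rewrite subset_leq_card // setIA (setIC (N y)) subsetIl.
Qed.

Lemma three_walks_le_light :
  \sum_(s in N u) \sum_(w in N s) #|N w| <= light_walks + D * heavy_walks g q u +
    \sum_(s in N u) heavy_walks g q s + (2 * q).+1 * D ^ 2.
Proof.
have split_ends s : \sum_(w in N s) #|N w| <=
    \sum_(w in N s :&: light_mids) #|light_ends s w| +
    \sum_(w in N s :&: light_mids) #|N w :\: light_ends s w| +
    #|N s :&: ~: light_mids| * D.
  rewrite (big_setID light_mids) /= -big_split -sum_nat_const setDE.
  apply: leq_add; last exact: leq_sum.
  apply: leq_sum => w _; rewrite -(cardsID (light_ends s w) (N w)) leq_add2r.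
  by rewrite subset_leq_card // subsetIr.
apply: leq_trans (leq_sum _ (fun s _ => split_ends s)) _.
rewrite !big_split /= -big_distrl sum_card_nbr_swap //=.
under [X in _ + X * _]eq_bigr => w _ do rewrite setIC -/(codeg g u w).
have := sum_codeg_not_light_mids; have := sum_not_light_ends.
rewrite -/light_walks; move: (\sum_(w in _) codeg g u w) => c; nia.
Qed.

End DegreeBound.

Lemma light_walks_ge p K delta :
    irreflexive g -> ~ has_copy g (L 3 (theta3 p)) -> 0 < K ->
    (forall v, delta <= #|N v| <= K * delta) ->
    3 * p + 4 <= q -> p + 8 * (2 * p + 1) * K ^ 3 <= q ->
    4 * ((2 * q).+1 * K ^ 2) <= delta ->
  delta ^ 3 <= 2 * light_walks.
Proof.
move=> gI no_copy K_gt0 degree pq q_large delta_large.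
have degree_ge v : delta <= #|N v| by case/andP: (degree v).
have degree_le v : #|N v| <= K * delta by case/andP: (degree v).
have lower : delta ^ 3 <= \sum_(s in N u) \sum_(w in N s) #|N w|.
  rewrite !expnS expn0 muln1.
  apply: leq_trans (_ : \sum_(s in N u) delta * delta <= _).
    by rewrite sum_nat_const leq_mul2r degree_ge orbT.
  apply: leq_sum => s _; apply: leq_trans (_ : \sum_(w in N s) delta <= _).
    by rewrite sum_nat_const leq_mul2r degree_ge orbT.
  by apply: leq_sum => w _.
have heavy_le s : 8 * K * heavy_walks g q s <= delta ^ 2.
  exact: (heavy_walks_le_degree gC gI no_copy).
have heavy_u : 8 * (K * delta * heavy_walks g q u) <= delta ^ 3.
  by rewrite expnSr; have := leq_mul (heavy_le u) (leqnn delta); lia.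
have heavy_N : 8 * (\sum_(s in N u) heavy_walks g q s) <= delta ^ 3.
  rewrite -(leq_pmul2l K_gt0) mulnA (mulnC K 8) big_distrr expnS mulnA.
  apply: leq_trans (_ : \sum_(s in N u) delta ^ 2 <= _); first exact: leq_sum.
  by rewrite sum_nat_const leq_mul2r degree_le orbT.
have end_walks_le : 4 * ((2 * q).+1 * (K * delta) ^ 2) <= delta ^ 3.
  by rewrite expnMn expnSr; have := leq_mul delta_large (leqnn (delta ^ 2)); lia.
have := leq_trans lower (three_walks_le_light degree_le); lia.
Qed.

End LightWalks.

(** * Almost regular graphs *)

Section Parents.
Variables (T : finType) (g : rel T) (q : nat) (u : T).
Hypotheses (gC : symmetric g) (gI : irreflexive g).
Local Notation N := (nbr g).

Lemma exists_best_parents : exists par : T -> T, forall w, 0 < codeg g u w ->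
  par w \in N u :&: N w /\
  \sum_(s in N u :&: N w) #|light_ends g q u s w| <=
    codeg g u w * #|light_ends g q u (par w) w|.
Proof.
suff /fin_all_exists[par parP] : forall w, exists s, 0 < codeg g u w ->
    s \in N u :&: N w /\ \sum_(s in N u :&: N w) #|light_ends g q u s w| <=
      codeg g u w * #|light_ends g q u s w| by exists par.
move=> w; case: (posnP (codeg g u w)) => [|/card_gt0P[s0 s0N]]; first by exists u.
case: (arg_maxnP (fun s => #|light_ends g q u s w|) s0N) => s sN s_max.
exists s => _; split=> //; rewrite -sum_nat_const.
by apply: leq_sum => t; apply: s_max.
Qed.

Variable par : T -> T.
Hypothesis par_nbr : forall w, 0 < codeg g u w -> par w \in N u :&: N w.

Definition parent_rel : rel T := fun w y =>
  [&& w \in light_mids g q u, 0 < codeg g u w & y \in light_ends g q u (par w) w].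

Lemma parent_relP w y : parent_rel w y ->
  [/\ g u (par w), g (par w) w & g w y] /\
  [/\ w != u, ~~ g u w, ~~ g u y & codeg g (par w) y < q].
Proof.
rewrite /parent_rel => /and3P[]; rewrite !inE => /and3P[wu _ uw] /par_nbr.
by rewrite !inE (gC w (par w)) => /andP[? ?] /and3P[? ? ?].
Qed.

Lemma light_walks_le_arcs :
    (forall w, 0 < codeg g u w -> \sum_(s in N u :&: N w) #|light_ends g q u s w| <=
      codeg g u w * #|light_ends g q u (par w) w|) ->
  light_walks g q u <= q * #|arcs parent_rel|.
Proof.
move=> par_best; rewrite /light_walks sum_nbr_swap // card_arcs big_distrr /=.
rewrite big_mkcond; apply: leq_sum => w _; case: ifP => // w_mid; rewrite setIC.
have [codeg0|codeg_gt0] := posnP (codeg g u w).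
  by rewrite (cards0_eq codeg0) big_set0.
apply: leq_trans (par_best w codeg_gt0) _; apply: leq_mul.
  by move: w_mid; rewrite inE => /and3P[_ /ltnW].
apply: subset_leq_card; apply/subsetP => y y_end.
by rewrite in_nbr /parent_rel w_mid codeg_gt0.
Qed.

Lemma card_parents_le D :
  (forall v, #|N v| <= D) -> #|fst @: arcs parent_rel| <= D ^ 2.
Proof.
move=> degree_le; apply: leq_trans (leq_mul (degree_le u) (leqnn D)).
apply: (leq_card_fibres (f := par)) => [w' /imsetP[[w y] + ->]|s _].
  by rewrite !inE => /parent_relP[[]].
apply: leq_trans (degree_le s); apply: subset_leq_card; apply/subsetP => w'.
move=> /setIdP[/imsetP[[w y] + ->] /eqP/= <-].
by rewrite !inE => /parent_relP[[]].
Qed.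

Lemma parent_colour_le y z :
  #|[set w in [set w | parent_rel w y] | par w == z]| <= q.
Proof.
apply: leq_card_inhabited => w0; rewrite !inE.
move=> /andP[/parent_relP[_ [_ _ _ codeg_lt]] /eqP w0z]; rewrite w0z in codeg_lt.
apply: leq_trans (ltnW codeg_lt); apply: subset_leq_card; apply/subsetP => w.
rewrite !inE => /andP[/parent_relP[[_ sw wy] _] /eqP <-].
by rewrite sw gC.
Qed.

Lemma no_rainbow_parent_copy (V : finType) (H : bigraph V) (f : V -> T) :
    (forall x, exists2 e, e \in edges H & x \in e) -> ~ has_copy g (L 3 H) ->
    bip_copy parent_rel H f ->
  ~ {in partA H &, injective (par \o f)}.
Proof.
move=> H_cover no_copy [f_inj f_edge] par_inj; apply: no_copy.
have f_arc x : exists2 ab, parent_rel (f ab.1) (f ab.2) &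
    x = ab.1 \/ x = ab.2 /\ x \in partB H.
  have [e eH] := H_cover x; have [a aA [b bB eE]] := parts_edges eH.
  have ab : parent_rel (f a) (f b) by apply: f_edge; rewrite -?eE.
  rewrite eE !inE => /orP[]/eqP xE; exists (a, b) => //=; [by left | right].
  by rewrite xE.
have f_far x : (f x != u) && ~~ g u (f x).
  have [[a b] /= /parent_relP[[_ _ ab] [au uanot ubnot _]] [->|[-> _]]] := f_arc x.
    by rewrite au.
  by rewrite ubnot andbT; apply: contraNneq uanot => <-; rewrite gC.
have fA_parent a : a \in partA H -> g u (par (f a)) && g (par (f a)) (f a).
  move=> aA; have [[a' b] /parent_relP[[ua aa _] _]] := f_arc a.
  case=> [->|[_ aB]]; first by rewrite /= ua.
  have := parts_disjoint H; rewrite disjoints_subset => /subsetP/(_ a aA).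
  by rewrite inE aB.
have f_copy : bip_copy g H f.
  by split=> // a b aA bB /(f_edge _ _ aA bB)/parent_relP[[]].
have f_neq_u x : f x != u by case/andP: (f_far x).
have s_inj : injective (fun a : {a | a \in partA H} => par (f (val a))).
  by move=> a a' /(par_inj _ _ (valP a) (valP a'))/val_inj.
apply: (L3_has_copy gI f_copy f_neq_u s_inj) => [a|a|a x].
- by case/andP: (fA_parent _ (valP a)).
- by case/andP: (fA_parent _ (valP a)).
- have /andP[ua _] := fA_parent _ (valP a); have /andP[_ ux] := f_far x.
  by apply: contraNneq ux => ->.
Qed.

End Parents.

Lemma theta3_edges_cover p (x : theta3_vertex p) : 0 < p ->
  exists2 e, e \in theta3_edges p & x \in e.
Proof.
move=> p_gt0; pose i0 := Ordinal p_gt0.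
have path_edge (i : 'I_p) e :
    e \in [set [set theta3_end p false; theta3_inner i false];
                [set theta3_inner i false; theta3_inner i true];
                [set theta3_inner i true; theta3_end p true]] ->
    e \in theta3_edges p.
  by move=> ei; apply/bigcupP; exists i.
case: x => [[]|[i []]].
- exists [set theta3_inner i0 true; theta3_end p true]; last exact: set22.
  by apply: (path_edge i0); rewrite !in_setU !in_set1 eqxx orbT.
- exists [set theta3_end p false; theta3_inner i0 false]; last exact: set21.
  by apply: (path_edge i0); rewrite !in_setU !in_set1 eqxx.
- exists [set theta3_inner i true; theta3_end p true]; last exact: set21.
  by apply: (path_edge i); rewrite !in_setU !in_set1 eqxx orbT.
- exists [set theta3_end p false; theta3_inner i false]; last exact: set22.
  by apply: (path_edge i); rewrite !in_setU !in_set1 eqxx.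
Qed.

Lemma light_walks_bound (T : finType) (g : rel T) p q u D :
    symmetric g -> irreflexive g -> ~ has_copy g (L 3 (theta3 p)) -> 0 < p ->
    (forall v, #|nbr g v| <= D) ->
  exists2 e, light_walks g q u <= q * e &
    e ^ 3 <= D ^ 2 * #|T| * (theta3_const p q * (e * D + D ^ 2 * #|T|)).
Proof.
move=> gC gI no_copy p_gt0 degree_le; have [par parP] := exists_best_parents g q u.
have par_nbr w : 0 < codeg g u w -> par w \in nbr g u :&: nbr g w by case/parP.
pose B := parent_rel g q u par; exists #|arcs B|.
  by apply: light_walks_le_arcs => // w /parP[].
have arcP w y : B w y -> g w y by move=> /(parent_relP gC par_nbr)[[]].
have BI : irreflexive B by move=> w; apply/negP => /arcP; rewrite gI.
have indegree_le y : #|[set w | B w y]| <= D.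
  apply: leq_trans (degree_le y); apply: subset_leq_card.
  by apply/subsetP => w; rewrite !inE gC => /arcP.
have outdegree_le w : #|[set y | B w y]| <= D.
  apply: leq_trans (degree_le w); apply: subset_leq_card.
  by apply/subsetP => y; rewrite !inE => /arcP.
have fst_le := card_parents_le q gC par_nbr degree_le; rewrite -/B in fst_le.
have no_rainbow f : bip_copy B (theta3 p) f ->
    ~ {in partA (theta3 p) &, injective (par \o f)}.
  by apply: no_rainbow_parent_copy no_copy => // x; exact: theta3_edges_cover.
have colour_le := parent_colour_le q gC par_nbr; rewrite -/B in colour_le.
have := rainbow_theta3_free_bound BI colour_le indegree_le outdegree_le no_rainbow.
by move/leq_trans; apply; rewrite !(leq_mul, leq_add).
Qed.

Lemma pow5_le_of_cube_le q K M m delta e : 0 < delta -> delta ^ 3 <= 2 * (q * e) ->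
    e ^ 3 <= (K * delta) ^ 2 * m * (M * (e * (K * delta) + (K * delta) ^ 2 * m)) ->
  delta ^ 5 <= ((8 * q ^ 2 * M * K ^ 3) ^ 2 + 16 * q ^ 3 * M * K ^ 4) * m ^ 2.
Proof.
move=> delta_gt0 lower upper; have e_gt0 : 0 < e.
  by case: e lower {upper} => // ; rewrite !muln0 leqn0 expn_eq0; lia.
have [many_arcs|few_arcs] := leqP ((K * delta) ^ 2 * m) (e * (K * delta)).
- apply: leq_trans (leq_mul (leq_addr _ _) (leqnn _)).
  set A := 8 * _ * _ * _; suff delta3_le : delta ^ 3 <= A * m.
    rewrite -expnMn; apply: leq_trans (_ : (delta ^ 3) ^ 2 <= _).
      by rewrite -expnM leq_pexp2l.
    by rewrite leq_exp2r.
  have e2_le : e ^ 2 <= 2 * M * K ^ 3 * m * delta ^ 3.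
    rewrite -(leq_pmul2l e_gt0) -expnS; apply: leq_trans upper _.
    rewrite [leqRHS](_ : _ =
        (K * delta) ^ 2 * m * (M * (e * (K * delta) + e * (K * delta)))).
      by rewrite leq_mul2l leq_mul2l leq_add2l many_arcs !orbT.
    by ring.
  rewrite -(@leq_pmul2r (delta ^ 3)) ?expn_gt0 ?delta_gt0 // mulnn.
  apply: leq_trans (_ : (2 * (q * e)) ^ 2 <= _); first by rewrite leq_exp2r.
  rewrite (_ : _ ^ 2 = 4 * q ^ 2 * e ^ 2); last by ring.
  by apply: leq_trans (leq_mul (leqnn _) e2_le) _; apply: eq_leq; rewrite /A; ring.
apply: leq_trans (leq_mul (leq_addl _ _) (leqnn _)).
have e3_le : e ^ 3 <= 2 * M * K ^ 4 * m ^ 2 * delta ^ 4.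
  apply: leq_trans upper _.
  rewrite [leqRHS](_ : _ =
      (K * delta) ^ 2 * m * (M * ((K * delta) ^ 2 * m + (K * delta) ^ 2 * m))).
    by rewrite leq_mul2l leq_mul2l leq_add2r (ltnW few_arcs) !orbT.
  by ring.
rewrite -(@leq_pmul2r (delta ^ 4)) ?expn_gt0 ?delta_gt0 // -expnD.
apply: leq_trans (_ : (2 * (q * e)) ^ 3 <= _).
  by rewrite (expnM delta 3 3 : delta ^ (5 + 4) = _) leq_exp2r.
rewrite (_ : _ ^ 3 = 8 * q ^ 3 * e ^ 3); last by ring.
by apply: leq_trans (leq_mul (leqnn _) e3_le) _; apply: eq_leq; ring.
Qed.

Lemma almost_regular_bound p K : 0 < p -> 0 < K -> exists C : nat,
  forall (T : finType) (g : rel T) (delta : nat), symmetric g -> irreflexive g ->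
    ~ has_copy g (L 3 (theta3 p)) -> 0 < #|T| ->
    (forall v, delta <= #|nbr g v| <= K * delta) ->
  delta ^ 5 <= C * #|T| ^ 2.
Proof.
move=> p_gt0 K_gt0; pose q := 4 * p + 4 + 8 * (2 * p + 1) * K ^ 3.
have pq : 3 * p + 4 <= q by rewrite /q; lia.
have q_large : p + 8 * (2 * p + 1) * K ^ 3 <= q by rewrite leq_add2r; lia.
pose d0 := 4 * ((2 * q).+1 * K ^ 2); set M := theta3_const p q.
exists ((8 * q ^ 2 * M * K ^ 3) ^ 2 + 16 * q ^ 3 * M * K ^ 4 + d0 ^ 5).
move=> T g delta gC gI no_copy T_gt0 degree; rewrite mulnDl.
have [delta_small|delta_large] := leqP delta d0.
  apply: leq_trans (leq_addl _ _); rewrite -[delta ^ 5]muln1.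
  by rewrite leq_mul ?leq_exp2r // expn_gt0 T_gt0.
apply: leq_trans (leq_addr _ _); have [u _] := card_gt0P T_gt0.
have degree_le v : #|nbr g v| <= K * delta by case/andP: (degree v).
have [e walks_le arcs_le] := light_walks_bound q u gC gI no_copy p_gt0 degree_le.
apply: pow5_le_of_cube_le arcs_le; first exact: leq_ltn_trans delta_large.
apply: leq_trans (_ : 2 * light_walks g q u <= _).
  exact: light_walks_ge pq q_large (ltnW delta_large).
by rewrite leq_mul2l walks_le.
Qed.

(** * Reduction to almost regular graphs *)

Lemma exists_subset_ge_average (X : finType) (f : X -> nat) (S : {set X}) k :
    k <= #|S| ->
  exists U : {set X}, [/\ U \subset S, #|U| = k &
    k * (\sum_(v in S) f v) <= #|S| * \sum_(v in U) f v].
Proof.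
move Sk : (#|S| - k) => n; elim: n S Sk => [|n IH] S Sk kS.
  by exists S; split=> //; [lia | rewrite (_ : #|S| = k) //; lia].
have /card_gt0P[v0 v0S] : 0 < #|S| by lia.
case: (arg_minnP f v0S) => v vS v_min; have {}vS : v \in S by [].
have cardS : #|S| = #|S :\ v|.+1 by rewrite (cardsD1 v S) vS.
have [||U [US Uk U_sum]] := IH (S :\ v); [lia | lia |].
exists U; split=> //; first exact: subset_trans US (subD1set _ _).
have sum_ge : #|S :\ v| * f v <= \sum_(w in S :\ v) f w.
  by rewrite -sum_nat_const; apply: leq_sum => w /setD1P[_ /v_min].
rewrite (big_setD1 v) //= cardS.
have [S0|S_gt0] := posnP #|S :\ v|; first by have -> : k = 0 by lia.
rewrite -(leq_pmul2l S_gt0); move: sum_ge U_sum.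
move: #|S :\ v| (\sum_(w in S :\ v) f w) (\sum_(w in U) f w) (f v) => s A B x.
by move=> /(leq_mul (leqnn k)) + /(leq_mul (leqnn s.+1)); lia.
Qed.

Section Regularise.
Variables (T : finType) (g : rel T).
Hypothesis gC : symmetric g.
Local Notation N := (nbr g).

Definition degree_sum (S : {set T}) : nat := \sum_(v in S) #|N v :&: S|.

Lemma degree_sum_setD_ge (S F : {set T}) : F \subset S ->
  degree_sum S <= degree_sum (S :\: F) + 2 * \sum_(v in F) #|N v :&: S|.
Proof.
move=> FS; rewrite mul2n -addnn addnA.
rewrite {1}/degree_sum (big_setID F) /= (setIidPr FS) addnC leq_add2r.
rewrite [X in _ <= _ + X]sum_card_nbr_swap // [X in _ <= _ + X](big_setID F) /=.
rewrite (setIidPr FS) addnCA.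
apply: leq_trans (leq_addl _ _); rewrite -big_split; apply: leq_sum => v _ /=.
rewrite -(cardsID F (N v :&: S)) setIDA addnC leq_add2l.
by rewrite subset_leq_card // setSI // subsetIl.
Qed.

Lemma degree_sum_le_sqr (S : {set T}) : degree_sum S <= #|S| ^ 2.
Proof.
rewrite -mulnn -sum_nat_const; apply: leq_sum => v _.
by rewrite subset_leq_card // subsetIr.
Qed.

Lemma exists_min_degree_subset (S : {set T}) : 0 < degree_sum S ->
  exists U : {set T}, [/\ U \subset S, 0 < #|U| &
    {in U, forall v, degree_sum S <= 2 * #|S| * #|N v :&: U|}].
Proof.
set E := degree_sum S => E_gt0.
pose dense := [pred U : {set T} |
  [&& U \subset S, 0 < degree_sum U & E * #|U| <= #|S| * degree_sum U]].
have denseS : dense S by rewrite /= subxx E_gt0 mulnC leqnn.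
case: (arg_minnP (fun U : {set T} => #|U|) denseS).
move=> U /and3P[US U_gt0 U_dense] U_min.
exists U; split=> // [|v vU].
  by rewrite card_gt0; apply: contraTneq U_gt0 => ->; rewrite /degree_sum big_set0.
rewrite leqNgt; apply/negP => v_poor; have : ~~ dense (U :\ v).
  by apply/negP => /U_min; rewrite (cardsD1 v U) vU ltnn.
have := @degree_sum_setD_ge U [set v]; rewrite sub1set big_set1 => /(_ vU) U_le.
apply/negP; rewrite negbK /= (subset_trans (subD1set _ _) US) /=.
rewrite (cardsD1 v U) vU in U_dense.
have := leq_mul (leqnn #|S|) U_le; rewrite mulnDr.
move: U_dense v_poor; move: (degree_sum (U :\ v)) => E'.
by case: E' => [|E'] /=; lia.
Qed.

Lemma exists_dense_superset (S F : {set T}) k : F \subset S -> k <= #|S| ->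
  exists2 U : {set T}, #|U| <= #|F| + k &
    k * (\sum_(v in F) #|N v :&: S|) <= #|S| * degree_sum U.
Proof.
move=> FS kS.
have [U [US Uk U_sum]] := exists_subset_ge_average (fun v => #|N v :&: F|) kS.
exists (F :|: U); first by rewrite cardsU Uk leq_subr.
rewrite sum_card_nbr_swap //; apply: leq_trans U_sum _.
rewrite leq_mul2l; apply/orP; right.
rewrite /degree_sum [leqRHS](big_setID U) /= (setIidPr (subsetUr F U)).
apply: leq_trans (leq_addr _ _); apply: leq_sum => v _.
by rewrite subset_leq_card // setIS // subsetUl.
Qed.

Section Induction.
Variables (a b C : nat).
Hypotheses (a_gt0 : 0 < a) (b_gt0 : 0 < b).
Let ratio := 2 ^ (3 * a + 2).
Hypothesis almost_regular_le : forall (U : {set T}) delta, 0 < #|U| ->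
    {in U, forall v, delta <= #|N v :&: U| <= 8 * ratio * delta} ->
  delta ^ a <= C * #|U| ^ b.

Let bound := ratio ^ a + 8 ^ a * C.

Let ratio_gt4 : 4 < ratio.
Proof. by rewrite (_ : 4 = 2 ^ 2) // ltn_exp2l // -[2]add0n ltn_add2r muln_gt0. Qed.

Let ratio_expn_ge : 2 ^ (3 * a + 2 * b) <= ratio ^ b.
Proof. by rewrite -expnM leq_exp2l // mulnDl leq_add2r leq_pmulr. Qed.

Definition high_degree (S : {set T}) : {set T} :=
  [set v in S | ratio * degree_sum S < #|N v :&: S| * #|S|].

Definition high_degree_sum (S : {set T}) : nat :=
  \sum_(v in high_degree S) #|N v :&: S|.

Lemma high_degree_sub (S : {set T}) : high_degree S \subset S.
Proof. by apply/subsetP => v /setIdP[]. Qed.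

Lemma card_high_degree (S : {set T}) :
  0 < degree_sum S -> ratio * #|high_degree S| <= #|S|.
Proof.
move=> E_gt0; rewrite -(leq_pmul2l E_gt0) mulnCA mulnA mulnC -sum_nat_const.
apply: leq_trans (_ : high_degree_sum S * #|S| <= _).
  by rewrite big_distrl; apply: leq_sum => v /setIdP[_ /ltnW].
rewrite leq_mul2r /degree_sum (big_setID (high_degree S)) /=.
by rewrite (setIidPr (high_degree_sub S)) leq_addr orbT.
Qed.

(* A [1 / ratio] share of the edges at high-degree vertices falls into a set [U]
   of about [2 |S| / ratio] vertices, to which the induction hypothesis applies. *)
Lemma degree_sum_le_of_high (S : {set T}) : ratio < #|S| -> 0 < degree_sum S ->
    (forall U : {set T}, #|U| < #|S| ->
      degree_sum U ^ a <= bound * #|U| ^ (a + b)) ->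
    degree_sum S <= 4 * high_degree_sum S ->
  degree_sum S ^ a <= bound * #|S| ^ (a + b).
Proof.
set m := #|S| => ratio_lt E_gt0 IH E_le; set F := high_degree S.
have ratio_gt0 : 0 < ratio by apply: leq_ltn_trans ratio_gt4.
pose k := (m %/ ratio).+1.
have ratio_k : ratio * k <= 2 * m by have := leq_divM m ratio; rewrite /k; lia.
have Fk : #|F| <= k.
  by apply: leqW; rewrite leq_divRL // mulnC card_high_degree.
have km : 2 * k < m by rewrite -(ltn_pmul2l ratio_gt0) mulnCA; nia.
have [||U U_le U_sum] := @exists_dense_superset S F k.
- exact: high_degree_sub.
- lia.
have U2k : #|U| <= 2 * k by lia.
have {}IH : degree_sum U ^ a <= bound * (2 * k) ^ (a + b).
  apply: leq_trans (IH U (leq_ltn_trans U2k km)) _.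
  by rewrite leq_mul2l leq_exp2r ?addn_gt0 ?a_gt0 // U2k orbT.
have high_le : (4 * high_degree_sum S) ^ a <=
    4 ^ a * m ^ a * (bound * 2 ^ (a + b) * k ^ b).
  rewrite -(@leq_pmul2l (k ^ a)) ?expn_gt0 // -[leqLHS]expnMn (mulnCA k 4) expnMn.
  apply: leq_trans (_ : 4 ^ a * (m * degree_sum U) ^ a <= _).
    by rewrite leq_mul2l leq_exp2r // U_sum orbT.
  rewrite expnMn; apply: leq_trans (leq_mul (leqnn _) (leq_mul (leqnn _) IH)) _.
  by apply: eq_leq; rewrite expnMn !expnD; ring.
rewrite -(@leq_pmul2l (ratio ^ b)) ?expn_gt0 ?ratio_gt0 //.
apply: leq_trans (_ : ratio ^ b * (4 * high_degree_sum S) ^ a <= _).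
  by rewrite leq_mul2l leq_exp2r // E_le orbT.
apply: leq_trans (leq_mul (leqnn _) high_le) _.
apply: leq_trans (_ : 4 ^ a * m ^ a * (bound * 2 ^ (a + b) * (2 * m) ^ b) <= _).
  rewrite mulnCA leq_mul2l mulnCA leq_mul2l -[leqLHS]expnMn leq_exp2r //.
  by rewrite ratio_k !orbT.
apply: leq_trans (leq_mul ratio_expn_ge (leqnn _)); apply: eq_leq.
have -> : 3 * a + 2 * b = a + a + a + b + b by lia.
by rewrite -[4]/(2 * 2) !expnMn !expnD; ring.
Qed.

Lemma degree_sum_le_of_low (S : {set T}) : 4 * #|S| <= degree_sum S ->
    4 * high_degree_sum S <= degree_sum S ->
  degree_sum S ^ a <= 8 ^ a * C * #|S| ^ (a + b).
Proof.
set m := #|S| => E_ge E_high; set E := degree_sum S in E_ge E_high *.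
have [->|E_gt0] := posnP E; first by rewrite exp0n.
have E_le : E <= 2 * degree_sum (S :\: high_degree S).
  have := degree_sum_setD_ge (high_degree_sub S).
  by rewrite -/E -/(high_degree_sum S); lia.
have [|U [US U_gt0 U_min]] := @exists_min_degree_subset (S :\: high_degree S).
  by lia.
have Sm : #|S :\: high_degree S| <= m by rewrite subset_leq_card // subsetDl.
have Um : #|U| <= m := leq_trans (subset_leq_card US) Sm.
have m_gt0 : 0 < m := leq_trans U_gt0 Um.
pose delta := E %/ (4 * m).
have m4_gt0 : 0 < 4 * m by rewrite muln_gt0.
have delta_gt0 : 0 < delta by rewrite divn_gt0.
have E_delta : E <= 8 * m * delta.
  by have := ltn_ceil E m4_gt0; rewrite -/delta; nia.
have regular : {in U, forall v, delta <= #|N v :&: U| <= 8 * ratio * delta}.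
  move=> v vU; apply/andP; split.
    rewrite -[leqRHS](mulKn _ m4_gt0) leq_div2r //; apply: leq_trans E_le _.
    apply: leq_trans (leq_mul (leqnn 2) (U_min v vU)) _.
    by have := leq_mul Sm (leqnn #|N v :&: U|); lia.
  have := subsetP US v vU; rewrite !inE => /andP[v_low vS].
  rewrite vS /= -leqNgt -/E -/m in v_low.
  rewrite -(leq_pmul2r m_gt0); apply: leq_trans (_ : #|N v :&: S| * m <= _).
    rewrite leq_mul2r subset_leq_card ?orbT // setIS //.
    by apply: subset_trans US _; exact: subsetDl.
  by apply: leq_trans v_low _; have := leq_mul (leqnn ratio) E_delta; lia.
apply: leq_trans (_ : (8 * m * delta) ^ a <= _); first by rewrite leq_exp2r.
rewrite !expnMn expnD.
have -> : 8 ^ a * C * (m ^ a * m ^ b) = 8 ^ a * m ^ a * (C * m ^ b) by ring.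
rewrite leq_mul2l; apply/orP; right.
apply: leq_trans (almost_regular_le U_gt0 regular) _.
by rewrite leq_mul2l leq_exp2r // Um orbT.
Qed.

Lemma degree_sum_le (S : {set T}) : degree_sum S ^ a <= bound * #|S| ^ (a + b).
Proof.
move Em : #|S| => m; elim/ltn_ind: m => m IH in S Em *.
have {}IH (U : {set T}) : #|U| < #|S| -> degree_sum U ^ a <= bound * #|U| ^ (a + b).
  by move=> US; apply: (IH #|U|); rewrite -?Em.
rewrite -Em; have [E0|E_gt0] := posnP (degree_sum S); first by rewrite E0 exp0n.
have m_gt0 : 0 < #|S| by have := degree_sum_le_sqr S; case: #|S| => [|//]; lia.
have scaled_card_le x : x <= ratio -> (x * #|S|) ^ a <= bound * #|S| ^ (a + b).
  move=> x_le; rewrite expnMn leq_mul //; last by rewrite leq_pexp2l // leq_addr.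
  by apply: leq_trans (leq_addr _ _); rewrite leq_exp2r.
have [le_ratio|ratio_lt] := leqP #|S| ratio.
  apply: leq_trans (scaled_card_le _ le_ratio); rewrite leq_exp2r //.
  exact: degree_sum_le_sqr.
have [E_lt|E_ge] := ltnP (degree_sum S) (4 * #|S|).
  apply: leq_trans (scaled_card_le 4 (ltnW ratio_gt4)).
  by rewrite leq_exp2r // ltnW.
have [high_le|high_gt] := leqP (4 * high_degree_sum S) (degree_sum S).
  apply: leq_trans (degree_sum_le_of_low E_ge high_le) _.
  by rewrite leq_mul2r leq_addl orbT.
exact: degree_sum_le_of_high ratio_lt E_gt0 IH (ltnW high_gt).
Qed.

End Induction.
End Regularise.

(** * Extremal numbers *)

Lemma card_nbr_induced (T : finType) (g : rel T) (U : {set T}) (v : {x | x \in U}) :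
  #|nbr (relpre val g) v| = #|nbr g (val v) :&: U|.
Proof.
rewrite -(card_imset _ val_inj); apply: eq_card => w; rewrite inE in_nbr.
apply/imsetP/andP => [[x + ->]|[vw wU]].
  by rewrite in_nbr; split=> //; exact: valP.
by exists (Sub w wU); rewrite ?in_nbr.
Qed.

Lemma L3_theta3_free_degree_sum_le p : 0 < p -> exists C : nat,
  forall (T : finType) (g : rel T), symmetric g -> irreflexive g ->
    ~ has_copy g (L 3 (theta3 p)) -> degree_sum g [set: T] ^ 5 <= C * #|T| ^ 7.
Proof.
move=> p_gt0; pose ratio := 2 ^ (3 * 5 + 2).
have [|C almost_regular_le] := @almost_regular_bound p (8 * ratio) p_gt0.
  by rewrite muln_gt0 expn_gt0.
exists (ratio ^ 5 + 8 ^ 5 * C) => T g gC gI no_copy.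
rewrite -cardsT; apply: (degree_sum_le gC (a := 5) (b := 2)) => //.
move=> U delta U_gt0 degree.
have <- : #|{: {x | x \in U}}| = #|U| by rewrite card_sig.
apply: (almost_regular_le {x | x \in U} (relpre val g) delta) => [x y|x||| v].
- exact: gC.
- exact: gI.
- by move/(has_copy_map val_inj).
- by rewrite card_sig.
- by rewrite card_nbr_induced; apply/degree/valP.
Qed.

Section Graphs.
Variables (W : finType) (G : graph W).

Definition adj : rel W := fun a b => [set a; b] \in edges G.

Lemma adj_sym : symmetric adj.
Proof. by move=> a b; rewrite /adj setUC. Qed.

Lemma adj_irr : irreflexive adj.
Proof.
move=> a; apply/negP => /(forall_inP (edges_card2 G)).
by rewrite setUid cards1.
Qed.

Lemma rel_edges_adj : rel_edges adj = edges G.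
Proof.
apply/setP => e; apply/imsetP/idP => [[[a b] + ->]|eG]; first by rewrite inE.
have /cards2P[a [b [_ eE]]] := forall_inP (edges_card2 G) e eG.
by exists (a, b); rewrite // inE /adj -eE.
Qed.

Lemma contains_of_has_copy (V : finType) (H : graph V) :
  has_copy adj H -> contains G H.
Proof.
case=> f f_inj; rewrite rel_edges_adj => f_edge; apply/existsP; exists (finfun f).
apply/andP; split; first by apply/injectiveP => a b; rewrite !ffunE => /f_inj.
apply/forall_inP => e /f_edge; rewrite (_ : f @: e = finfun f @: e) //.
by apply: eq_imset => x; rewrite ffunE.
Qed.

Lemma card_edges_le_degree_sum : #|edges G| <= degree_sum adj [set: W].
Proof.
rewrite -rel_edges_adj; apply: leq_trans (leq_imset_card _ _) _.
rewrite card_arcs eq_leq //; apply: eq_big => [w|w _]; first by rewrite inE.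
by rewrite setIT.
Qed.

End Graphs.

Lemma ex_pow5_le p : 0 < p -> exists C : nat,
  forall n, ex n (L 3 (theta3 p)) ^ 5 <= C * n ^ 7.
Proof.
move=> p_gt0; have [C degree_sum_le] := L3_theta3_free_degree_sum_le p_gt0.
exists C => n.
rewrite /ex; apply: (big_ind (fun k => k ^ 5 <= C * n ^ 7)) => // [k l|G /negP noL].
  by rewrite /maxn; case: ifP.
apply: leq_trans (_ : degree_sum (adj G) [set: 'I_n] ^ 5 <= _).
  by rewrite leq_exp2r // card_edges_le_degree_sum.
rewrite -[n in n ^ 7]card_ord; apply: degree_sum_le (adj_sym G) (adj_irr G) _.
by move/contains_of_has_copy.
Qed.

Import Order.TTheory GRing.Theory Num.Theory.
Local Open Scope ring_scope.

Theorem theorem5p2 (R : realType) (p : nat) (hp : (2 <= p)%N) :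
  exists2 c : R, 0 < c &
    forall n : nat, (ex n (L 3 (theta3 p)))%:R <= c * n%:R `^ (7 / 5).
Proof.
have [C ex_le] := ex_pow5_le (ltnW hp).
exists C.+1%:R => [|n]; first by rewrite ltr0n.
rewrite -(@ler_pXn2r _ 5) ?nnegrE ?mulr_ge0 ?ler0n ?powR_ge0 // exprMn.
have -> : ((n%:R : R) `^ (7 / 5)) ^+ 5 = n%:R ^+ 7.
  rewrite -(powR_mulrn 5 (powR_ge0 _ _)) -powRrM -(powR_mulrn 7 (ler0n R n)).
  by congr (_ `^ _); rewrite divfK ?pnatr_eq0.
rewrite -!natrX -natrM ler_nat; apply: leq_trans (ex_le n) _.
rewrite leq_mul2r; apply/orP; right; apply: leq_trans (leqnSn C) _.
by rewrite -[X in (X <= _)%N]expn1 leq_pexp2l.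
Qed.
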